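(* Let $M$ be a target manifold with its fixed open cover $\{U_i\}_{i\in J}$. A $U(1)$-bundle with connection $(g_{ij},A_j)_{i,j\in J}$ on $M$ gives rise to a rank-$1$, embedded, $1$-dimensional TQFT $(Z',Z)$ with target $M$ via $$Z'(y^+,i,j)=g_{ij}(y),\qquad Z'(y^-,i,j)=\overline{g_{ij}(y)},$$ $$Z(p,T)=\exp\Big(\mathrm{i}\int_{x_0}^{x_1}p^*A_{i_1}\Big)\, g_{i_1i_2}(p(x_1))\,\exp\Big(\mathrm{i}\int_{x_1}^{x_2}p^*A_{i_2}\Big)\, g_{i_2i_3}(p(x_2))\cdots\exp\Big(\mathrm{i}\int_{x_{N-1}}^{x_N}p^*A_{i_N}\Big).$$
   Context: Here $\mathrm{i}$ denotes the imaginary unit. Target: $M$ is a fixed finite-dimensional smooth real manifold with an open cover $\{U_i\}_{i\in J}$ such that every non-empty finite intersection $U_{i_1\ldots i_p}=U_{i_1}\cap\cdots\cap U_{i_p}$ is contractible. Bundles with connection: a $U(1)$-bundle with connection on $M$ is a collection of smooth functions $g_{ij}:U_{ij}\to U(1)$ and smooth real $1$-forms $A_j\in\Lambda^1(U_j)$ satisfying (B1) $g_{ij}g_{jk}=g_{ik}$ on $U_{ijk}$ and (B2) $\mathrm{i}(A_k-A_j)=d\log g_{jk}$ on $U_{jk}$. Objects: an irreducible subobject is $(y^\pm,i)$ with $y\in U_i$ and a sign. For $y\in U_i\cap U_j$, $(y^\pm,i,j)$ denotes the isomorphism $(y^\pm,i)\to(y^\pm,j)$. An object $(p,T)$ is a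 smooth path $p:[a,b]\to M$ that is constant on $[a,a+\epsilon[$ and on $]b-\epsilon,b]$ for some $\epsilon>0$, with a labelled partition $T$: points $a=x_0<x_1<\dots<x_N=b$ and labels $i_\alpha\in J$ with $p([x_{\alpha-1},x_\alpha])\subset U_{i_\alpha}$, $\alpha=1,\dots,N$. TQFT: a rank-$1$, embedded, $1$-dimensional TQFT (with target $M$) is a pair of assignments $(y^\pm,i,j)\mapsto Z'(y^\pm,i,j)\in U(1)$, $(p,T)\mapsto Z(p,T)\in U(1)$ such that: (i) $Z'(y^\pm,i,j)Z'(y^\pm,j,k)=Z'(y^\pm,i,k)$ for $y\in U_{ijk}$; (ii) for objects $(p,T)$ with $p:[a,b]\to M$ and labels $i_1,\dots,i_N$, and $(p',T')$ with $p':[a',b']\to M$ and labels $i'_1,\dots,i'_{N'}$, and any orientation-preserving diffeomorphism $f:[a,b]\to[a',b']$ with $p=p'\circ f$ (no requirement relating $T$ and $T'$), $Z(p',T')=Z'(p(a)^-,i_1,i'_1)\,Z(p,T)\,Z'(p(b)^+,i_N,i'_{N'})$; (iii) for $(p,T)$ on $[a,b]$ and $(p',T')$ on $[b,c]$ with $p(b)=p'(b)$, $Z(p\circ p',T\circ T')=Z(p,T)\,Z'(p(b)^+,i_N,i'_1)\,Z(p',T')$, where $p\circ p':[a,c]\to M$ is $p$ on $[a,b]$ and $p'$ on $[b,c]$, and $T\circ T'$ is the concatenated labelled partition of $[a,c]$. *)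

(* Defs.v *)
From mathcomp Require Export all_boot all_order all_algebra complex.
From mathcomp Require Export all_classical all_reals all_analysis.

#[export] Set Implicit Arguments.
#[export] Unset Strict Implicit.
#[export] Unset Printing Implicit Defensive.

Export Order.TTheory GRing.Theory Num.Theory.
Export numFieldNormedType.Exports.

#[export] Set Warnings "-notation-overridden".

Local Open Scope classical_set_scope.
Local Open Scope ring_scope.

(* For V finite-dimensional and D open this is the usual C^k: quantifying over
   all directions v, instead of the vectors of a basis, makes no difference. *)
Fixpoint Ck (R : realType) (V W : normedModType R) (k : nat) (D : set V)
    (f : V -> W) : Prop :=
  (forall x, D x -> {for x, continuous f}) /\
  match k with
  | 0 => True
  | k'.+1 => forall v : V, (forall x, D x -> derivable f x v) /\
                           Ck k' D (fun x => 'D_v f x)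
  end.

Definition Cinfty (R : realType) (V W : normedModType R) (D : set V)
  (f : V -> W) : Prop := forall k, Ck k D f.

(* Smoothness on a set that need not be open: local smooth extendability. *)
Definition smooth_on (R : realType) (V W : normedModType R) (D : set V)
    (f : V -> W) : Prop :=
  forall x, D x -> exists (N : set V) (h : V -> W),
    [/\ open N, N x, Cinfty N h & forall z, N z -> D z -> h z = f z].

(* Smooth manifolds without boundary, of dimension n, given by an atlas
   (not required to be maximal); [chart_inv c] is only meaningful on
   [chart_map c @` chart_dom c], and [chart_map c] on [chart_dom c]. *)
Record smoothManifold (R : realType) (n : nat) := SmoothManifold {
  manifold_carrier :> topologicalType;
  chart_index : Type;
  chart_dom : chart_index -> set manifold_carrier;
  chart_map : chart_index -> manifold_carrier -> 'rV[R]_n;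
  chart_inv : chart_index -> 'rV[R]_n -> manifold_carrier;
  manifold_hausdorff : hausdorff_space manifold_carrier;
  manifold_second_countable : @second_countable manifold_carrier;
  chart_dom_open : forall c, open (chart_dom c);
  chart_img_open : forall c, open (chart_map c @` chart_dom c);
  chart_mapK : forall c y, chart_dom c y -> chart_inv c (chart_map c y) = y;
  chart_map_continuous : forall c y, chart_dom c y ->
    {for y, continuous (chart_map c)};
  chart_inv_continuous : forall c y, chart_dom c y ->
    {for chart_map c y, continuous (chart_inv c)};
  chart_cover : forall y, exists c, chart_dom c y;
  chart_compatible : forall c c',
    Cinfty (chart_map c @` (chart_dom c `&` chart_dom c'))
           (chart_map c' \o chart_inv c) }.

Section Manifold.
Context (R : realType) (n : nat) (M : smoothManifold R n).

Definition chart_at (y : M) : chart_index M := projT1 (cid (chart_cover y)).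

Definition smooth_fun (U : set M) (h : M -> R) : Prop :=
  forall c : chart_index M,
    Cinfty (chart_map c @` (U `&` chart_dom c)) (h \o chart_inv c : _ -> R).

(* Value of dh at y on the tangent vector with coordinates v in the chart c. *)
Definition dfun (h : M -> R) (c : chart_index M) (y : M) (v : 'rV[R]_n) : R :=
  'D_v (h \o chart_inv c : _ -> R) (chart_map c y).

(* [form_at c y v] is the value of the form at y on the tangent vector whose
   coordinates in the chart c are v; a tangent vector with coordinates v in the
   chart c has coordinates D(chart_map c' \o chart_inv c) v in the chart c'.
   Only the values at y in U and in the domain of c are meaningful. *)
Record one_form (U : set M) := OneForm {
  form_at : chart_index M -> M -> 'rV[R]_n -> R;
  form_linear : forall c y, (U `&` chart_dom c) y ->
    forall (a : R) (v w : 'rV[R]_n),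
      form_at c y (a *: v + w) = a * form_at c y v + form_at c y w;
  form_change : forall c c' y v, (U `&` chart_dom c `&` chart_dom c') y ->
    form_at c y v =
    form_at c' y ('D_v (chart_map c' \o chart_inv c) (chart_map c y));
  form_smooth : forall c v,
    Cinfty (chart_map c @` (U `&` chart_dom c))
           (fun x => form_at c (chart_inv c x) v : R) }.

Definition smooth_path (a b : R) (p : R -> M) : Prop :=
  {within `[a, b], continuous p} /\
  forall c : chart_index M,
    smooth_on [set t : R | t \in `[a, b] /\ chart_dom c (p t)]
              (chart_map c \o p : R -> 'rV[R]_n).

(* The coefficient of dt in p^*A; by [form_change] the choice of chart is
   irrelevant at points where p is differentiable. *)
Definition pullback (U : set M) (A : one_form U) (p : R -> M) (t : R) : R :=
  let c := chart_at (p t) in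
  form_at A c (p t) ('D_1 (chart_map c \o p : R -> 'rV[R]_n) t).

End Manifold.

Section Topology.
Context (R : realType).

Definition contractible (M : topologicalType) (A : set M) : Prop :=
  exists (H : R * M -> M) (y0 : M),
    [/\ A y0,
        {within `[0, 1]%classic `*` A, continuous H},
        forall s y, s \in `[0, 1] -> A y -> A (H (s, y)),
        forall y, A y -> H (0, y) = y
      & forall y, A y -> H (1, y) = y0].

Definition good_cover (M : topologicalType) (J : Type) (U : J -> set M) :
    Prop :=
  [/\ forall i, open (U i),
      \bigcup_i U i = setT
    & forall S : set J, finite_set S -> S !=set0 ->
        \bigcap_(i in S) U i !=set0 -> contractible (\bigcap_(i in S) U i)].

End Topology.

Definition U1 (R : realType) : set R[i] := [set z | `|z| = 1].

Definition expi (R : realType) (x : R) : R[i] := (cos x +i* sin x)%C.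

Section Bundle.
Context (R : realType) (n : nat) (M : smoothManifold R n).
Context (J : Type) (U : J -> set M).

(* Smoothness of g_ij into U(1) is smoothness of its real and imaginary parts;
   d log g is dg / g. *)
Record bundle_with_connection := BundleWithConnection {
  bg : J -> J -> M -> R[i];
  bA : forall j, one_form (U j);
  bg_U1 : forall i j y, (U i `&` U j) y -> U1 (bg i j y);
  bg_smooth : forall i j,
    smooth_fun (U i `&` U j) (fun y => complex.Re (bg i j y)) /\
    smooth_fun (U i `&` U j) (fun y => complex.Im (bg i j y));
  bundle_B1 : forall i j k y, (U i `&` U j `&` U k) y ->
    bg i j y * bg j k y = bg i k y;
  bundle_B2 : forall j k y (c : chart_index M) (v : 'rV[R]_n),
    (U j `&` U k `&` chart_dom c) y ->
    'i%C * ((form_at (bA k) c y v - form_at (bA j) c y v)%:C)%C =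
    (dfun (fun z => complex.Re (bg j k z)) c y v +i*
     dfun (fun z => complex.Im (bg j k z)) c y v)%C / bg j k y }.

End Bundle.

(* [LPartition x0 i1 x1 [:: (i2, x2); ...; (iN, xN)]] is the partition
   x0 < x1 < ... < xN, where [x_(k-1), x_k] has the label i_k. *)
Record lpartition (R : realType) (J : Type) := LPartition {
  lp_start : R;
  lp_head : J;
  lp_cut : R;
  lp_tail : seq (J * R) }.

Section Partitions.
Context (R : realType) (J : Type).
Implicit Types T : lpartition R J.

Definition lp_points T : seq R :=
  [:: lp_start T, lp_cut T & [seq u.2 | u <- lp_tail T]].

Definition lp_end T : R := last (lp_start T) (lp_points T).

Definition lp_last T : J := last (lp_head T) [seq u.1 | u <- lp_tail T].

Definition lp_concat T T' : lpartition R J :=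
  LPartition (lp_start T) (lp_head T) (lp_cut T)
    (lp_tail T ++ (lp_head T', lp_cut T') :: lp_tail T').

Fixpoint subordinate (M : Type) (U : J -> set M) (p : R -> M) (x : R)
    (s : seq (J * R)) : Prop :=
  match s with
  | [::] => True
  | (i, x') :: s' => p @` `[x, x'] `<=` U i /\ subordinate U p x' s'
  end.

End Partitions.

Section TQFT.
Context (R : realType) (n : nat) (M : smoothManifold R n).
Context (J : Type) (U : J -> set M).

(* The path is a map on [lp_start T, lp_end T]; the values of p outside this
   interval are irrelevant. *)
Definition is_object (p : R -> M) (T : lpartition R J) : Prop :=
  let a := lp_start T in let b := lp_end T in
  [/\ sorted <%R (lp_points T),
      smooth_path a b p,
      exists2 e : R, 0 < e & (forall t, t \in `[a, a + e[ -> p t = p a) /\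
                             (forall t, t \in `]b - e, b] -> p t = p b)
    & subordinate U p a ((lp_head T, lp_cut T) :: lp_tail T)].

(* A smooth bijection [a, b] -> [a', b'] with smooth inverse, of positive
   derivative; at the endpoints positivity follows by continuity, as the
   derivative of a diffeomorphism does not vanish. *)
Definition oriented_diffeo (a b a' b' : R) (f : R -> R) : Prop :=
  exists g : R -> R,
    [/\ [/\ forall t, t \in `[a, b] -> f t \in `[a', b'],
            forall t, t \in `[a', b'] -> g t \in `[a, b],
            forall t, t \in `[a, b] -> g (f t) = t
          & forall t, t \in `[a', b'] -> f (g t) = t],
        smooth_on `[a, b]%classic f, smooth_on `[a', b']%classic g
      & forall t, t \in `]a, b[ -> 0 < 'D_1 f t].

Definition path_concat (p p' : R -> M) (b : R) : R -> M :=
  fun t => if t <= b then p t else p' t.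

Variant sign := Plus | Minus.

(* [Z' s y i j] stands for Z'(y^s, i, j), meaningful for y in U_i and U_j, and
   [Z p T] is meaningful for objects (p, T). *)
Record is_TQFT (Z' : sign -> M -> J -> J -> R[i])
    (Z : (R -> M) -> lpartition R J -> R[i]) : Prop := IsTQFT {
  tqft_U1' : forall s y i j, (U i `&` U j) y -> U1 (Z' s y i j);
  tqft_U1 : forall p T, is_object p T -> U1 (Z p T);
  tqft_cocycle : forall s y i j k, (U i `&` U j `&` U k) y ->
    Z' s y i j * Z' s y j k = Z' s y i k;
  tqft_diffeo : forall p T p' T' (f : R -> R),
    is_object p T -> is_object p' T' ->
    oriented_diffeo (lp_start T) (lp_end T) (lp_start T') (lp_end T') f ->
    (forall t, t \in `[lp_start T, lp_end T] -> p t = p' (f t)) ->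
    Z p' T' = Z' Minus (p (lp_start T)) (lp_head T) (lp_head T') * Z p T *
              Z' Plus (p (lp_end T)) (lp_last T) (lp_last T');
  tqft_gluing : forall p T p' T',
    is_object p T -> is_object p' T' ->
    lp_end T = lp_start T' -> p (lp_end T) = p' (lp_end T) ->
    Z (path_concat p p' (lp_end T)) (lp_concat T T') =
    Z p T * Z' Plus (p (lp_end T)) (lp_last T) (lp_head T') * Z p' T' }.

Context (B : bundle_with_connection U).

Definition bundle_Z' (s : sign) (y : M) (i j : J) : R[i] :=
  match s with Plus => bg B i j y | Minus => (bg B i j y)^* end.

Definition exp_integral (p : R -> M) (x : R) (i : J) (x' : R) : R[i] :=
  expi (\int[lebesgue_measure]_(t in `[x, x']) pullback (bA B i) p t).

Fixpoint transport (p : R -> M) (x : R) (i : J) (x' : R) (s : seq (J * R)) :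
    R[i] :=
  exp_integral p x i x' *
  match s with
  | [::] => 1
  | (j, x'') :: s' => bg B i j (p x') * transport p x' j x'' s'
  end.

Definition bundle_Z (p : R -> M) (T : lpartition R J) : R[i] :=
  transport p (lp_start T) (lp_head T) (lp_cut T) (lp_tail T).

End TQFT.

(* Main.v *)
From HB Require Import structures.
Require Import Defs.
From mathcomp Require Import ring lra.

(** The number Z(p, T) is the parallel transport of the bundle along p,
    written in the local trivialisations that are named by the labels of T.
    Each part of the statement says that this does not depend on the way it is
    written.

    The analytic content is one computation. Along a path that stays in U_i
    and U_j, relation (B2) is the linear differential equation g' = i (A_j -
    A_i) g for the transition function g = g_ij o p, so that g times the
    exponential of the integral of i (A_i - A_j) is constant. This is
    [gauge_transformation]: changing the label of an interval multiplies its
    factor by the values of g_ij at the two ends. Given this, two labelled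
    partitions of one path are compared by running through them simultaneously
    ([transport_relabel]): relation (B1) makes the transition functions cancel
    at every interior point, and only those at the two ends of the path
    survive. A reparametrisation f moves the partition of p' to p without
    changing any factor, by the chain rule ([transport_reparam]); together
    with the previous comparison this is the diffeomorphism axiom. The gluing
    axiom holds term by term ([transport_cat]), as the integrals over the two
    halves do not see the junction point ([eq_transport]).

    Most of the work goes into making the integrals accessible to calculus.
    The differentiability class in use speaks of directional derivatives only,
    so the chain rule requires that a C^1 function has a total differential
    ([C1_differentiable]). It follows that the coefficient of p^*A does not
    depend on the chart and is continuous inside the interval of p; it
    vanishes near the ends because p is constant there. Hence it has a
    primitive ([pullback_primitive]), and the equalities between integrals
    that are needed reduce to equalities between derivatives. *)

Local Open Scope classical_set_scope.
Local Open Scope ring_scope.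

(** * Differential calculus in row spaces *)

Section Calculus.
Context {R : realType}.

Lemma is_derive_line (V W : normedModType R) (f : V -> W) (y v : V) (s : R) :
  derivable f (s *: v + y) v ->
  is_derive s 1 (fun u : R => f (u *: v + y)) ('D_v f (s *: v + y)).
Proof.
have E : (fun h : R => h^-1 *: (f ((h *: 1 + s) *: v + y) - f (s *: v + y))) =
         (fun h : R => h^-1 *: (f (h *: v + (s *: v + y)) - f (s *: v + y))).
  by apply/funext => h; rewrite [h *: 1]mulr1 scalerDl addrA.
move=> df; apply: DeriveDef; first by rewrite /derivable /= E.
by rewrite /derive /= E.
Qed.

(** The constant c stands for the derivative of f in the direction v at a
    nearby reference point, so that the bound measures how far f is from being
    affine along a segment that need not pass through that point. *)
Lemma mean_value_bound (V : normedModType R) (f : V -> R) (y v : V) (s c e : R) :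
  (forall u : R, `|u| <= `|s| -> derivable f (u *: v + y) v) ->
  (forall u : R, `|u| <= `|s| -> `|'D_v f (u *: v + y) - c| <= e) ->
  `|f (s *: v + y) - f y - s * c| <= e * `|s|.
Proof.
move=> df dfc; pose F (u : R) := f (u *: v + y).
have dF (u : R) : `|u| <= `|s| -> is_derive u 1 F ('D_v f (u *: v + y)).
  by move=> us; apply: is_derive_line; exact: df.
have cF (a b : R) : `|a| <= `|s| -> `|b| <= `|s| ->
    {within `[a, b], continuous F}.
  move=> sa sb; apply: derivable_within_continuous => u; rewrite in_itv/= => ub.
  have us : `|u| <= `|s|.
    by move: sa sb ub; rewrite !ler_norml => ? ? ?; lra.
  by case: (dF u us).
have F0 : F 0 = f y by rewrite /F scale0r add0r.
have n0 : `|0 : R| <= `|s| by rewrite normr0.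
have [s0|s0|->] := ltgtP s 0; last first.
- by rewrite scale0r add0r subrr mul0r subrr normr0 mulr0.
- have dF' u : u \in `]0, s[ -> is_derive u 1 F ('D_v f (u *: v + y)).
    by rewrite in_itv/= => us; apply: dF; rewrite !gtr0_norm; lra.
  have [u us E] := MVT s0 dF' (cF _ _ n0 (lexx _)).
  have -> : f (s *: v + y) - f y = 'D_v f (u *: v + y) * s.
    by rewrite -F0 -[f _]/(F s) E subr0.
  rewrite [s * c]mulrC -mulrBl normrM ler_wpM2r// dfc//.
  by move: us; rewrite in_itv/= => us; rewrite !gtr0_norm; lra.
- have dF' u : u \in `]s, 0[ -> is_derive u 1 F ('D_v f (u *: v + y)).
    by rewrite in_itv/= => us; apply: dF; rewrite !ltr0_norm; lra.
  have [u us E] := MVT s0 dF' (cF _ _ (lexx _) n0).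
  have -> : f (s *: v + y) - f y = 'D_v f (u *: v + y) * s.
    by move: E; rewrite -F0 -[f (s *: _ + _)]/(F s) => E; lra.
  rewrite [s * c]mulrC -mulrBl normrM ler_wpM2r// dfc//.
  by move: us; rewrite in_itv/= => us; rewrite !ltr0_norm; lra.
Qed.

Lemma differentiable_of_linear (V W : normedModType R) (f : V -> W)
    (df : {linear V -> W}) (x : V) :
  continuous df ->
  (forall e : R, 0 < e ->
    \forall h \near 0, `|f (h + x) - f x - df h| <= e * `|h|) ->
  differentiable f x.
Proof.
move=> cdf dfP.
have E : f \o shift x = cst (f x) + df +o_ 0 id.
  apply/eqaddoP => e e0; apply: filterS (dfP e e0) => h /=.
  by rewrite !fctE opprD addrA.
apply/diff_locallyP; have dfE := diff_unique cdf E.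
by rewrite dfE.
Qed.

Lemma rV_ballP (n : nat) (x y : 'rV[R]_n) (r : R) :
  0 < r -> ball x r y <-> forall k, `|x 0 k - y 0 k| < r.
Proof.
move=> r0; split=> [[_ xy] k|xy]; first exact: (xy 0 k).
by split=> // i k; rewrite ord1; exact: xy.
Qed.

(** The class C^1 is defined through directional derivatives, but the chain
    rule needs a total differential. The increment f(x + h) - f(x) is
    telescoped along the polygon from x to x + h that changes one coordinate
    at a time: every edge is parallel to an axis, hence is controlled by
    [mean_value_bound], and all vertices stay in the ball of radius |h| around
    x. *)
Lemma C1_differentiable (n : nat) (D : set 'rV[R]_n) (f : 'rV[R]_n -> R) :
  open D -> Ck 1 D f -> forall x, D x -> differentiable f x.
Proof.
move=> oD [_ df] x Dx.
pose e_ (k : 'I_n) : 'rV[R]_n := delta_mx 0 k.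
pose c (k : 'I_n) := 'D_(e_ k) f x.
pose d (h : 'rV[R]_n) := \sum_k h 0 k * c k.
have lin_d : linear d.
  move=> a u v; rewrite /d scaler_sumr -big_split/=; apply: eq_bigr => k _.
  by rewrite !mxE mulrDl -mulrA.
pose dM := GRing.isLinear.Build _ _ _ _ _ lin_d.
pose dL : {linear 'rV[R]_n -> R} := HB.pack d dM.
have cd : continuous dL.
  apply: continuous_big => [|k _]; first exact: add_continuous.
  move=> z; apply: (@cvgMr_tmp _ _ (nbhs z) _ (fun h : 'rV[R]_n => h 0 k)).
  exact: coord_continuous.
apply: (differentiable_of_linear cd) => e e0.
(* The successor keeps the divisor nonzero in dimension 0. *)
pose e' := e / n.+1%:R.
have e'0 : 0 < e' by rewrite divr_gt0.
have : \forall y \near x, D y /\ forall k, `|'D_(e_ k) f y - c k| <= e'.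
  apply: filterI; first exact: open_nbhs_nbhs.
  apply: (filter_forall (nbhs_filter (x : 'rV[R]_n))) => k.
  have [_ [/(_ x Dx) /cvgrPdist_le /(_ _ e'0) + _]] := df (e_ k).
  by apply: filterS => y; rewrite distrC.
move=> /nbhs_ballP[r /= r0 rP].
near=> h => /=.
have hr k : `|h 0 k| < r.
  have : ball (0 : 'rV[R]_n) r h by near: h; exact: nbhsx_ballx.
  by move/(rV_ballP _ _ r0)/(_ k); rewrite mxE sub0r normrN.
(* The vertex where the first k coordinates have been changed. *)
pose y_ (k : nat) : 'rV[R]_n := x + \row_i (if (i < k)%N then h 0 i else 0).
have y0 : y_ 0%N = x.
  by rewrite /y_ -[RHS]addr0; congr +%R; apply/rowP => i; rewrite !mxE.
have yn : y_ n = h + x.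
  by rewrite /y_ addrC; congr +%R; apply/rowP => i; rewrite !mxE ltn_ord.
have yS (k : 'I_n) : y_ k.+1 = h 0 k *: e_ k + y_ k.
  apply/rowP => i; rewrite !mxE/= ltnS leq_eqVlt.
  have [->|ik] := eqVneq i k; first by rewrite eqxx ltnn mulr1 addr0 addrC.
  by rewrite eqE/= in ik; rewrite (negbTE ik)/= mulr0 add0r.
have term (k : 'I_n) :
    `|f (y_ k.+1) - f (y_ k) - h 0 k * c k| <= e' * `|h 0 k|.
  have P (u : R) : `|u| <= `|h 0 k| -> ball x r (u *: e_ k + y_ k).
    move=> us; apply/rV_ballP => // j; rewrite !mxE eqxx/=.
    rewrite [X in _ - X]addrCA opprD addrA subrr sub0r normrN.
    have [->|jk] := eqVneq j k.
      by rewrite ltnn mulr1 addr0 (le_lt_trans us).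
    rewrite mulr0 add0r; case: ifP => _; first exact: hr.
    by rewrite normr0.
  rewrite yS; apply: mean_value_bound => u /P/rP[Du]; last exact.
  by move=> _; have [+ _] := df (e_ k); exact.
have -> : f (h + x) - f x - dL h =
    \sum_k (f (y_ (nat_of_ord k).+1) - f (y_ k) - h 0 k * c k).
  rewrite sumrB; congr (_ - _).
  rewrite -(big_mkord xpredT (fun k => f (y_ k.+1) - f (y_ k))).
  rewrite telescope_sumr//.
  by rewrite y0 yn.
apply: le_trans (ler_norm_sum _ _ _) _.
apply: (@le_trans _ _ (\sum_(k < n) e' * `|h|)).
  apply: ler_sum => k _; apply: (le_trans (term k)).
  rewrite ler_wpM2l ?(ltW e'0)//.
  by rewrite [leRHS]/Num.Def.normr/= mx_normrE; exact: (le_bigmax _ _ (0, k)).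
rewrite sumr_const card_ord -mulr_natl mulrA ler_wpM2r//.
rewrite /e' mulrA ler_pdivrMr// mulrC ler_wpM2l ?(ltW e0)// ler_nat.
exact: leqnSn.
Unshelve. all: by end_near. Qed.

Lemma chain_rule_curve (n : nat) (D : set 'rV[R]_n) (f : 'rV[R]_n -> R)
    (g : R -> 'rV[R]_n) (t : R) :
  open D -> Ck 1 D f -> D (g t) -> derivable g t 1 ->
  is_derive t 1 (f \o g) ('D_('D_1 g t) f (g t)).
Proof.
move=> oD Cf Dg /derivable1_diffP dg.
have df := C1_differentiable oD Cf Dg.
have dfg : differentiable (f \o g) t by exact: differentiable_comp.
apply: DeriveDef; first exact/derivable1_diffP.
by rewrite !deriveE// diff_comp.
Qed.

(** Componentwise from the scalar case; this is the form in which changes of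
    chart are applied to the velocity of a path. *)
Lemma chain_rule_curve_mx (m n : nat) (D : set 'rV[R]_n)
    (f : 'rV[R]_n -> 'rV[R]_m) (g : R -> 'rV[R]_n) (t : R) :
  open D -> Ck 1 D f -> D (g t) -> derivable g t 1 ->
  is_derive t 1 (f \o g) ('D_('D_1 g t) f (g t)).
Proof.
move=> oD [cf df] Dg dg.
have Cf i j : Ck 1 D (fun x => f x i j).
  split=> [x Dx|v].
    apply: (@continuous_comp _ _ _ f (fun M : 'rV_m => M i j)).
      exact: cf.
    exact: coord_continuous.
  have [dfv [cfv _]] := df v; split=> [x Dx|].
    by have /derivable_mxP := dfv _ Dx; exact.
  split=> // x Dx.
  have E : \forall y \near x, 'D_v f y i j = 'D_v (fun x => f x i j) y.
    have : \forall y \near x, D y by exact: open_nbhs_nbhs.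
    by apply: filterS => y Dy; rewrite derive_mx ?mxE//; exact: dfv.
  rewrite /prop_for /continuous_at -(nbhs_singleton E).
  apply: cvg_trans (near_eq_cvg E) _.
  apply: (@continuous_comp _ _ _ ('D_v f) (fun M : 'rV_m => M i j)).
    exact: cfv.
  exact: coord_continuous.
have H i j := chain_rule_curve oD (Cf i j) Dg dg.
have dfg : derivable (f \o g) t 1.
  by apply/derivable_mxP => i j; case: (H i j).
have [/(_ _ Dg)/derive_mx E _] := df ('D_1 g t).
refine (DeriveDef dfg (etrans (derive_mx dfg) (etrans _ (esym E)))).
by apply/matrixP => i j; rewrite !mxE; case: (H i j).
Qed.

Lemma derive_reparam (W : normedModType R) (G : R -> W) (f : R -> R) (t : R) :
  derivable f t 1 -> derivable G (f t) 1 ->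
  'D_1 (G \o f) t = 'D_1 f t *: 'D_1 G (f t).
Proof.
move=> /derivable1_diffP df /derivable1_diffP dG.
have dGf : differentiable (G \o f) t by exact: differentiable_comp.
have E := congr1 (fun h : R -> W => h 1) (diff_comp df dG).
apply: etrans (deriveE _ dGf) _; apply: etrans E _.
have -> : 'D_1 f t = 'd f t 1 by exact: deriveE.
have -> : 'D_1 G (f t) = 'd G (f t) 1 by exact: deriveE.
have E1 := linearZ_LR ('d G (f t)) ('d f t 1) 1.
by apply: etrans E1; exact: (congr1 ('d G (f t)) (esym (mulr1 _))).
Qed.

End Calculus.

(** * Pulling back one-forms along smooth paths *)

(** Near an interior point of D the function is equal to one of its smooth
    local extensions, so it inherits the derivatives of the latter. *)
Lemma smooth_on_interior (R : realType) (V W : normedModType R) (D : set V)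
    (g : V -> W) (x v : V) :
  smooth_on D g -> nbhs x D ->
  derivable g x v /\ {for x, continuous (fun y => 'D_v g y)}.
Proof.
move=> sg nD; have [N [h [oN Nx sh hg]]] := sg x (nbhs_singleton nD).
have hgx : \forall z \near x, h z = g z.
  by apply: filterS2 nD (open_nbhs_nbhs (conj oN Nx)) => z Dz Nz; exact: hg.
have [_ /(_ v)[dh [ch _]]] := sh 1%N.
split; first by apply: near_eq_derivable hgx _; exact: dh.
have hgx' : \forall z \near x, 'D_v h z = 'D_v g z.
  have : \forall z \near x, \forall y \near z, h y = g y by exact: near_join.
  by apply: filterS => z; exact: near_eq_derive.
rewrite /prop_for /continuous_at -(nbhs_singleton hgx').
by apply: cvg_trans (near_eq_cvg hgx') _; exact: ch.
Qed.

Lemma smooth_on_continuous (R : realType) (V W : normedModType R) (D : set V)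
    (g : V -> W) :
  smooth_on D g -> {within D, continuous g}.
Proof.
move=> sg; apply/subspace_continuousP => x Dx.
have [N [h [oN Nx sh hg]]] := sg x Dx.
have [/(_ x Nx) ch _] := sh 0%N.
suff : g @ within D (nbhs x) --> h x by rewrite (hg x Nx Dx).
apply: (@cvg_trans _ (h @ within D (nbhs x))); last first.
  by apply: cvg_trans ch; apply: cvg_app; exact: cvg_within.
apply: near_eq_cvg; apply: filterS (open_nbhs_nbhs (conj oN Nx)) => z Nz Dz.
exact: hg.
Qed.

Section Manifold.
Context (R : realType) (n : nat) (M : smoothManifold R n).
Implicit Types (c : chart_index M) (p : R -> M).

(** Open coordinate domains are what [chain_rule_curve] asks for; the
    functions and transition maps of the theory live on sets of this form. *)
Lemma open_chart_image c (V : set M) :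
  open V -> open (chart_map c @` (V `&` chart_dom c)).
Proof.
move=> oV; rewrite openE => _ [y [Vy cy] <-]; rewrite /interior.
have : \forall z \near chart_map c y, (V `&` chart_dom c) (chart_inv c z).
  apply: (chart_inv_continuous cy); rewrite chart_mapK//.
  apply: open_nbhs_nbhs; split=> //; apply: openI => //.
  exact: chart_dom_open.
have : \forall z \near chart_map c y, (chart_map c @` chart_dom c) z.
  by apply: open_nbhs_nbhs; split; [exact: chart_img_open|exists y].
apply: filterS2 => _ [y' cy' <-]; rewrite chart_mapK// => Vy'; exists y'.
Qed.

Lemma chart_at_dom (y : M) : chart_dom (chart_at y) y.
Proof. exact: projT2 (cid (chart_cover y)). Qed.

Section Path.
Context (a b : R) (p : R -> M).
Hypothesis sp : smooth_path a b p.

Lemma path_continuous t : t \in `]a, b[ -> {for t, continuous p}.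
Proof.
move=> tab; have [cp _] := sp.
have : {within `]a, b[, continuous p}.
  by apply: continuous_subspaceW cp; exact: subset_itv_oo_cc.
rewrite continuous_open_subspace; last exact: interval_open.
by apply; rewrite inE.
Qed.

Lemma path_near (V : set M) t : open V -> t \in `]a, b[ -> V (p t) ->
  \forall s \near t, (s \in `]a, b[) /\ V (p s).
Proof.
move=> oV tab Vt; apply: filterI; first exact: near_in_itvoo.
by apply: (path_continuous tab); exact: open_nbhs_nbhs.
Qed.

Lemma path_velocity c t : t \in `]a, b[ -> chart_dom c (p t) ->
  derivable (chart_map c \o p) t 1 /\
  {for t, continuous (fun s => 'D_1 (chart_map c \o p) s)}.
Proof.
move=> tab ct; have [_ /(_ c) sc] := sp.
apply: smooth_on_interior sc _.
apply: filterS (path_near (chart_dom_open c) tab ct) => s /=.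
by case=> sab cs; split=> //; exact: subset_itv_oo_cc.
Qed.

Lemma path_derive c (D : set M) (m : nat) (F : 'rV[R]_n -> 'rV[R]_m) t :
  open D -> Ck 1 (chart_map c @` (D `&` chart_dom c)) F ->
  t \in `]a, b[ -> D (p t) -> chart_dom c (p t) ->
  is_derive t 1 (F \o (chart_map c \o p))
    ('D_('D_1 (chart_map c \o p) t) F (chart_map c (p t))).
Proof.
move=> oD CF tab Dt ct; have [dp _] := path_velocity tab ct.
by apply: chain_rule_curve_mx CF _ dp; [exact: open_chart_image|exists (p t)].
Qed.

Context (U : set M) (A : one_form U).
Hypothesis oU : open U.

Lemma form_at0 c y : U y -> chart_dom c y -> form_at A c y 0 = 0.
Proof.
move=> Uy cy; have := form_linear A (conj Uy cy) (- 1) 0 0.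
by rewrite scaler0 addr0 mulN1r addNr.
Qed.

Lemma form_at_sum c y (v : 'rV[R]_n) : U y -> chart_dom c y ->
  form_at A c y v = \sum_k v 0 k * form_at A c y (delta_mx 0 k).
Proof.
move=> Uy cy; rewrite {1}(row_sum_delta v).
elim/big_rec2: _ => [|k x w _ <-]; first exact: form_at0.
by rewrite (form_linear A).
Qed.

(** The chart chosen by [pullback] may jump with t. The rule [form_change] and
    the chain rule for the transition map compensate each other, so that the
    coefficient can be computed in a chart that is kept fixed while t varies.
    *)
Lemma pullbackE c t : t \in `]a, b[ -> U (p t) -> chart_dom c (p t) ->
  pullback A p t = form_at A c (p t) ('D_1 (chart_map c \o p) t).
Proof.
move=> tab Ut ct; rewrite /pullback; set c0 := chart_at (p t).
have c0t : chart_dom c0 (p t) by exact: chart_at_dom.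
rewrite (@form_change _ _ _ _ A c0 c)//; congr (form_at A c (p t) _).
have CF := @chart_compatible _ _ M c0 c 1%N.
rewrite setIC in CF.
have [_ <-] := path_derive (chart_dom_open c) CF tab ct c0t.
apply: near_eq_derive; apply: filterS (path_near (chart_dom_open c0) tab c0t).
by move=> s [_ c0s] /=; rewrite chart_mapK.
Qed.

Lemma pullback_continuous t : t \in `]a, b[ -> U (p t) ->
  {for t, continuous (pullback A p)}.
Proof.
move=> tab Ut; pose c := chart_at (p t).
have ct : chart_dom c (p t) by exact: chart_at_dom.
(* The chart c of the point p t is kept for all nearby parameters s. *)
pose F s := \sum_k 'D_1 (chart_map c \o p) s 0 k *
  form_at A c (chart_inv c (chart_map c (p s))) (delta_mx 0 k).
have FE : \forall s \near t, F s = pullback A p s.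
  have := path_near (openI oU (chart_dom_open c)) tab (conj Ut ct).
  apply: filterS => s [sab [Us cs]].
  rewrite (pullbackE sab Us cs) form_at_sum//; apply: eq_bigr => k _.
  by rewrite chart_mapK.
rewrite /prop_for /continuous_at -(nbhs_singleton FE).
apply: cvg_trans (near_eq_cvg FE) _.
have [_ cv] := path_velocity tab ct.
apply: cvg_big => [|k _]; first exact: add_continuous.
apply: cvgM.
  apply: (@continuous_comp _ _ _ (fun s => 'D_1 (chart_map c \o p) s)
    (fun v : 'rV[R]_n => v 0 k)) => //; exact: coord_continuous.
have cF := form_smooth A c (delta_mx 0 k) 0%N.
have cc : {for t, continuous (fun s => chart_map c (p s))}.
  apply: continuous_comp; first exact: path_continuous.
  exact: chart_map_continuous.
apply: (@continuous_comp _ _ _ _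
  (fun x => form_at A c (chart_inv c x) (delta_mx 0 k)) _ cc).
by apply: (proj1 cF); exists (p t).
Qed.

Lemma pullback_flat t : (\forall s \near t, p s = p t) -> U (p t) ->
  pullback A p t = 0.
Proof.
move=> flat Ut; rewrite /pullback.
have -> : 'D_1 (chart_map (chart_at (p t)) \o p) t = 0 :> 'rV[R]_n.
  rewrite -(derive_cst (chart_map (chart_at (p t)) (p t)) t (1 : R)).
  by apply: near_eq_derive; apply: filterS flat => s /= ->.
by apply: form_at0 => //; exact: chart_at_dom.
Qed.

End Path.
End Manifold.

(** * Integrals and primitives on a segment *)

Lemma within_continuous_comp (T1 T2 T3 : topologicalType) (D : set T1)
    (E : set T2) (f : T1 -> T2) (g : T2 -> T3) :
  {within D, continuous f} -> {within E, continuous g} ->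
  (forall t, D t -> E (f t)) -> {within D, continuous (g \o f)}.
Proof.
move=> /subspace_continuousP cf /subspace_continuousP cg DE.
apply/subspace_continuousP => t Dt.
apply: cvg_trans (cg _ (DE t Dt)) => V /= gV.
have : nbhs (f t) (fun z => E z -> V (g z)) := gV.
move=> /(cf t Dt) H.
have {}H : nbhs t (fun s => D s -> E (f s) -> V (g (f s))) := H.
suff : nbhs t (fun s => D s -> V (g (f s))) by [].
by apply: filterS H => s H Ds; exact: H Ds (DE s Ds).
Qed.

Section Integrals.
Context {R : realType}.
Local Notation mu := (@lebesgue_measure R).

Lemma derive0_eq_ends (a b : R) (F : R -> R) :
  a < b -> {within `[a, b], continuous F} ->
  (forall t, t \in `]a, b[ -> is_derive t 1 F 0) -> F b = F a.
Proof.
move=> ab cF dF; have [c _ E] := MVT ab dF cF.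
by apply/eqP; rewrite -subr_eq0 E mul0r.
Qed.

Lemma eq_Rintegral_oo (a b : R) (f F : R -> R) :
  (forall t, t \in `]a, b[ -> {for t, continuous F}) ->
  (forall t, t \in `]a, b[ -> f t = F t) ->
  \int[mu]_(t in `[a, b]) f t = \int[mu]_(t in `[a, b]) F t.
Proof.
move=> cF fF; have mF : measurable_fun `]a, b[ F.
  apply: measurable_realfun.open_continuous_measurable_fun => // t.
  by rewrite inE; exact: cF.
rewrite /Rintegral; congr fine; apply: eq_integral_itv_bounded => //.
by apply: eq_measurable_fun mF => t; rewrite inE => /fF.
Qed.

(** The integrand is allowed to be wild at the two ends of the segment, which
    have measure zero. *)
Lemma primitive_exists (a b : R) (f F : R -> R) : a < b ->
  (forall t, t \in `[a, b] -> {for t, continuous F}) ->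
  (forall t, t \in `]a, b[ -> f t = F t) ->
  exists Phi : R -> R,
    [/\ {within `[a, b], continuous Phi},
        forall t, t \in `]a, b[ -> is_derive t 1 Phi (f t)
      & forall s t, a <= s -> s <= t -> t <= b ->
          \int[mu]_(u in `[s, t]) f u = Phi t - Phi s].
Proof.
move=> ab cF fF; pose Phi x := \int[mu]_(u in `[a, x]) F u.
have iF : mu.-integrable `[a, b] (EFin \o F).
  apply: continuous_compact_integrable; first exact: segment_compact.
  by apply: continuous_in_subspaceT => t; rewrite inE; exact: cF.
exists Phi; split.
- exact: parameterized_integral_continuous (ltW ab) iF.
- move=> t tab; have := tab; rewrite in_itv/= => /andP[at_ tb].
  have [dP E] := continuous_FTC1_closed tb iF at_ (cF t (subset_itv_oo_cc tab)).
  by apply: DeriveDef; rewrite // -derive1E E fF.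
- move=> s t as_ st tb.
  have sub (u : R) : u \in `]s, t[ -> u \in `]a, b[.
    rewrite !in_itv/= => /andP[su ut].
    by rewrite (le_lt_trans as_)//= (lt_le_trans ut).
  rewrite (@eq_Rintegral_oo _ _ _ F); last 2 first.
  + by move=> u /sub uab; apply: cF; exact: subset_itv_oo_cc.
  + by move=> u /sub; exact: fF.
  rewrite /Phi Rintegral_itvB//.
  + rewrite Rintegral_itv_obnd_cbnd//.
    apply: integrableS iF => // u; rewrite /= !in_itv/= => /andP[su ut].
    by rewrite (le_trans as_ (ltW su))/= (le_trans ut).
  + apply: integrableS iF => // u; rewrite /= !in_itv/= => /andP[-> ut].
    exact: le_trans ut tb.
Qed.

End Integrals.

Section Expi.
Context {R : realType}.

Lemma expiD (x y : R) : expi (x + y) = expi x * expi y.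
Proof.
rewrite /expi cosD sinD; apply/eqP; rewrite eq_complex/=.
by apply/andP; split; apply/eqP; ring.
Qed.

Lemma norm_expi (x : R) : `|expi x| = 1.
Proof. by rewrite /expi normc_def/= cos2Dsin2 sqrtr1. Qed.

End Expi.

(** * Connection coefficients along a path *)

Section Arcs.
Context (R : realType) (n : nat) (M : smoothManifold R n).

(** The conditions of [is_object] on the path alone, so that they can be kept
    while the partition is cut into smaller pieces. *)
Definition flat_path (a b : R) (p : R -> M) : Prop :=
  smooth_path a b p /\
  exists2 e : R, 0 < e & (forall t, t \in `[a, a + e[ -> p t = p a) /\
                         (forall t, t \in `]b - e, b] -> p t = p b).

(** Since p stays still near a and b, the coefficient vanishes in ]a, b[ near
    both ends. Extended by 0 outside ]a, b[ it is therefore continuous up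
    to the ends, where the two-sided derivative of p is not controlled. *)
Lemma pullback_extension (a b x x' : R) (p : R -> M) (U : set M)
    (A : one_form U) :
  flat_path a b p -> open U -> a <= x -> x' <= b ->
  (forall t, t \in `[x, x'] -> U (p t)) ->
  exists F : R -> R, (forall t, t \in `[x, x'] -> {for t, continuous F}) /\
    (forall t, t \in `]x, x'[ -> pullback A p t = F t).
Proof.
move=> [sp [e e0 [flata flatb]]] oU ax xb Up.
exists (fun t => if t \in `]a, b[ then pullback A p t else 0); split; last first.
  move=> t; rewrite !in_itv/= => /andP[xt tx].
  by rewrite (le_lt_trans ax xt) (lt_le_trans tx xb).
move=> t txx; have Ut := Up t txx.
have [tab|] := boolP (t \in `]a, b[).
  rewrite /prop_for /continuous_at tab.
  apply: cvg_trans (pullback_continuous sp oU tab Ut).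
  apply: near_eq_cvg; apply: filterS (near_in_itvoo tab) => s sab.
  by rewrite sab.
have cst0 (f : R -> R) : (\forall s \near t, 0 = f s) -> {for t, continuous f}.
  move=> f0; rewrite /prop_for /continuous_at -(nbhs_singleton f0).
  by apply: cvg_trans (near_eq_cvg f0) _; exact: cvg_cst.
move: (txx); rewrite !in_itv/= negb_and -!leNgt => /andP[xt tx'] /orP[ta|bt].
- have {ta}ta : t = a by lra.
  subst t.
  apply: cst0; near=> s; case: ifPn => // /andP[]; rewrite !bnd_simp => sa sb.
  have sae : s < a + e by near: s; apply: lt_nbhsl; lra.
  have E u : a < u -> u < a + e -> p u = p a.
    by move=> au ue; apply: flata; rewrite in_itv/= (ltW au).
  apply/esym/pullback_flat => //; last by rewrite E.
  have : s \in `]a, a + e[ by rewrite in_itv/= sa.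
  move=> /near_in_itvoo; apply: filterS => u; rewrite in_itv/= => /andP[? ?].
  by rewrite !E.
- have {bt}tb : t = b by lra.
  subst t.
  apply: cst0; near=> s; case: ifPn => // /andP[]; rewrite !bnd_simp => sa sb.
  have sbe : b - e < s by near: s; apply: lt_nbhsr; lra.
  have E u : b - e < u -> u < b -> p u = p b.
    by move=> au ue; apply: flatb; rewrite in_itv/= au (ltW ue).
  apply/esym/pullback_flat => //; last by rewrite E.
  have : s \in `]b - e, b[ by rewrite in_itv/= sbe.
  move=> /near_in_itvoo; apply: filterS => u; rewrite in_itv/= => /andP[? ?].
  by rewrite !E.
Unshelve. all: by end_near. Qed.

(** All that is used of the integrals of the connection forms: they are the
    increments of a function that solves Phi' = pullback A p. *)
Lemma pullback_primitive (a b x x' : R) (p : R -> M) (U : set M)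
    (A : one_form U) :
  flat_path a b p -> open U -> a <= x -> x < x' -> x' <= b ->
  (forall t, t \in `[x, x'] -> U (p t)) ->
  exists Phi : R -> R,
    [/\ {within `[x, x'], continuous Phi},
        forall t, t \in `]x, x'[ -> is_derive t 1 Phi (pullback A p t)
      & forall s t, x <= s -> s <= t -> t <= x' ->
         \int[lebesgue_measure]_(u in `[s, t]) pullback A p u = Phi t - Phi s].
Proof.
move=> fp oU ax xx xb Up.
have [F [cF pF]] := pullback_extension A fp oU ax xb Up.
exact: primitive_exists cF pF.
Qed.

Lemma smooth_fun_continuous (U : set M) (h : M -> R) (y : M) :
  open U -> smooth_fun U h -> U y -> {for y, continuous h}.
Proof.
move=> oU sh Uy; pose c := chart_at y; have cy : chart_dom c y := chart_at_dom y.
have [ch _] := sh c 0%N.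
have E : \forall z \near y, (h \o chart_inv c) (chart_map c z) = h z.
  have : \forall z \near y, chart_dom c z.
    by apply: open_nbhs_nbhs; split=> //; exact: chart_dom_open.
  by apply: filterS => z cz /=; rewrite chart_mapK.
rewrite /prop_for /continuous_at -(nbhs_singleton E).
apply: cvg_trans (near_eq_cvg E) _.
apply: (@continuous_comp _ _ _ (chart_map c) (h \o chart_inv c)).
  exact: chart_map_continuous.
by apply: ch; exists y.
Qed.

Lemma path_derive_fun (a b : R) (p : R -> M) (U : set M) (h : M -> R)
    (c : chart_index M) (t : R) :
  smooth_path a b p -> open U -> smooth_fun U h ->
  t \in `]a, b[ -> U (p t) -> chart_dom c (p t) ->
  is_derive t 1 (h \o p) (dfun h c (p t) ('D_1 (chart_map c \o p) t)).
Proof.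
move=> sp oU sh tab Ut ct; have [dp _] := path_velocity sp tab ct.
have oC := @open_chart_image _ _ M c _ oU.
have Dt : (chart_map c @` (U `&` chart_dom c)) (chart_map c (p t)).
  by exists (p t).
apply: near_eq_is_derive (chain_rule_curve oC (sh c 1%N) Dt dp).
apply: filterS (path_near sp (chart_dom_open c) tab ct) => s [_ cs] /=.
by rewrite chart_mapK.
Qed.

Context (J : Type) (U : J -> set M) (B : bundle_with_connection U).
Hypothesis oU : forall i, open (U i).

(** Relation (B2) along a path: the transition function g = g_ij o p solves g'
    = i w g, where w is the difference of the two connection coefficients; the
    two statements are the real and imaginary parts of this equation. *)
Lemma bundle_derive (i j : J) (a b : R) (p : R -> M) (t : R) :
  smooth_path a b p -> t \in `]a, b[ -> U i (p t) -> U j (p t) ->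
  let w := pullback (bA B j) p t - pullback (bA B i) p t in
  is_derive t 1 (fun s => complex.Re (bg B i j (p s)))
    (- w * complex.Im (bg B i j (p t))) /\
  is_derive t 1 (fun s => complex.Im (bg B i j (p s)))
    (w * complex.Re (bg B i j (p t))).
Proof.
move=> sp tab Ui Uj w; pose c := chart_at (p t).
have ct : chart_dom c (p t) := chart_at_dom _.
have oUij := openI (oU i) (oU j).
have [sRe sIm] := bg_smooth B i j.
have dRe := path_derive_fun sp oUij sRe tab (conj Ui Uj) ct.
have dIm := path_derive_fun sp oUij sIm tab (conj Ui Uj) ct.
have B2 := @bundle_B2 _ _ _ _ _ B i j (p t) c ('D_1 (chart_map c \o p) t)
  (conj (conj Ui Uj) ct).
rewrite -/(pullback (bA B i) p t) -/(pullback (bA B j) p t) -/w in B2.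
have g0 : bg B i j (p t) != 0.
  by rewrite -normr_eq0 (bg_U1 B (conj Ui Uj)) oner_eq0.
move: dRe dIm B2; set du := dfun _ _ _ _; set dv := dfun _ _ _ _ => dRe dIm.
move=> /(congr1 (fun z => z * bg B i j (p t))); rewrite divfK//.
case E : (bg B i j (p t)) => [u v] /eqP.
rewrite eq_complex/= => /andP[/eqP E1 /eqP E2]; split.
  by apply: is_derive_eq; rewrite -E1; ring.
by apply: is_derive_eq; rewrite -E2; ring.
Qed.

End Arcs.

(** * Parallel transport and change of partition *)

Section Transport.
Context (R : realType) (n : nat) (M : smoothManifold R n).
Context (J : Type) (U : J -> set M) (B : bundle_with_connection U).
Hypothesis oU : forall i, open (U i).

Lemma exp_integral_split (a b : R) (p : R -> M) (i : J) (x y z : R) :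
  flat_path a b p -> a <= x -> x < y -> y < z -> z <= b ->
  (forall t, t \in `[x, z] -> U i (p t)) ->
  exp_integral B p x i z = exp_integral B p x i y * exp_integral B p y i z.
Proof.
move=> fp ax xy yz zb Up.
have xz := lt_trans xy yz.
have [Phi [_ _ intE]] := pullback_primitive (bA B i) fp (oU i) ax xz zb Up.
rewrite /exp_integral -expiD; congr expi.
rewrite !intE ?(ltW xy) ?(ltW yz) ?lexx ?(ltW xz)//.
by ring.
Qed.

Lemma transport_split (a b : R) (p : R -> M) (i : J) (x y z : R)
    (s : seq (J * R)) :
  flat_path a b p -> a <= x -> x < y -> y < z -> z <= b ->
  (forall t, t \in `[x, z] -> U i (p t)) ->
  transport B p x i z s = exp_integral B p x i y * transport B p y i z s.
Proof.
move=> fp ax xy yz zb Up; have E := exp_integral_split fp ax xy yz zb Up.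
by case: s => [|[k w] s] /=; rewrite E -mulrA.
Qed.

(** Let P and Q be primitives of the coefficients of A_i and A_j along p. By
    [bundle_derive] the function expi (P - Q) * (g_ij o p) has derivative
    zero, so it takes the same value at x and y. *)
Lemma gauge_transformation (a b : R) (p : R -> M) (i j : J) (x y : R) :
  flat_path a b p -> a <= x -> x < y -> y <= b ->
  (forall t, t \in `[x, y] -> U i (p t) /\ U j (p t)) ->
  exp_integral B p x i y * bg B i j (p y) =
  bg B i j (p x) * exp_integral B p x j y.
Proof.
move=> fp ax xy yb Up; have sp := fp.1.
have [P [cP dP PE]] :=
  pullback_primitive (bA B i) fp (oU i) ax xy yb (fun t h => (Up t h).1).
have [Q [cQ dQ QE]] :=
  pullback_primitive (bA B j) fp (oU j) ax xy yb (fun t h => (Up t h).2).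
pose u s := complex.Re (bg B i j (p s)).
pose v s := complex.Im (bg B i j (p s)).
pose th s := P s - Q s.
have xyab : `[x, y] `<=` `[a, b].
  by move=> t; rewrite /= !in_itv/= => /andP[? ?]; lra.
have oUij := openI (oU i) (oU j).
have cg (h : M -> R) : smooth_fun (U i `&` U j) h ->
    {within `[x, y], continuous (fun s => h (p s))}.
  move=> sh; have [cp _] := sp.
  have cp' := continuous_subspaceW xyab cp.
  apply/subspace_continuousP => t txy.
  have ch := smooth_fun_continuous oUij sh (Up t txy).
  move/subspace_continuousP : cp' => /(_ t txy) cpt.
  exact: cvg_comp cpt ch.
have [sRe sIm] := bg_smooth B i j.
have cu : {within `[x, y], continuous u} := cg _ sRe.
have cv : {within `[x, y], continuous v} := cg _ sIm.
have cth : {within `[x, y], continuous th}.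
  by move=> t; apply: cvgB; [exact: cP|exact: cQ].
have ccos : {within `[x, y], continuous (fun s => cos (th s))}.
  by move=> t; apply: continuous_comp; [exact: cth|exact: continuous_cos].
have csin : {within `[x, y], continuous (fun s => sin (th s))}.
  by move=> t; apply: continuous_comp; [exact: cth|exact: continuous_sin].
have dth t : t \in `]x, y[ ->
    is_derive t 1 th (pullback (bA B i) p t - pullback (bA B j) p t).
  move=> txy; have dPt := dP t txy; have dQt := dQ t txy.
  exact: is_deriveB.
have dcos t : t \in `]x, y[ -> is_derive t 1 (fun s => cos (th s))
    (- sin (th t) * (pullback (bA B i) p t - pullback (bA B j) p t)).
  move=> txy; have dt := dth t txy.
  by apply: is_derive_eq; rewrite /GRing.scale/= mulrC.
have dsin t : t \in `]x, y[ -> is_derive t 1 (fun s => sin (th s))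
    (cos (th t) * (pullback (bA B i) p t - pullback (bA B j) p t)).
  move=> txy; have dt := dth t txy.
  by apply: is_derive_eq; rewrite /GRing.scale/= mulrC.
have dg t : t \in `]x, y[ ->
    let w := pullback (bA B j) p t - pullback (bA B i) p t in
    is_derive t 1 u (- w * v t) /\ is_derive t 1 v (w * u t).
  move=> txy; have [Ui Uj] := Up t (subset_itv_oo_cc txy).
  apply: bundle_derive Ui Uj => //; first exact: sp.
  by move: txy; rewrite !in_itv/= => /andP[? ?]; lra.
(* Real and imaginary parts of the function that is shown to be constant. *)
have E1 : cos (th y) * u y - sin (th y) * v y =
          cos (th x) * u x - sin (th x) * v x.
  apply: (@derive0_eq_ends _ _ _
    (fun s => cos (th s) * u s - sin (th s) * v s)) => //.
    move=> t; apply: cvgB; apply: cvgM;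
      [exact: ccos|exact: cu|exact: csin|exact: cv].
  move=> t txy; have d1 := dcos t txy; have d2 := dsin t txy.
  have [d3 d4] := dg t txy.
  by apply: is_derive_eq; rewrite /GRing.scale/=; ring.
have E2 : sin (th y) * u y + cos (th y) * v y =
          sin (th x) * u x + cos (th x) * v x.
  apply: (@derive0_eq_ends _ _ _
    (fun s => sin (th s) * u s + cos (th s) * v s)) => //.
    move=> t; apply: cvgD; apply: cvgM;
      [exact: csin|exact: cu|exact: ccos|exact: cv].
  move=> t txy; have d1 := dcos t txy; have d2 := dsin t txy.
  have [d3 d4] := dg t txy.
  by apply: is_derive_eq; rewrite /GRing.scale/=; ring.
have E : expi (th y) * bg B i j (p y) = expi (th x) * bg B i j (p x).
  move: E1 E2; rewrite /u /v /expi.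
  case: (bg B i j (p y)) => u1 v1; case: (bg B i j (p x)) => u0 v0 /= E1 E2.
  by apply/eqP; rewrite eq_complex/=; apply/andP; split; apply/eqP; lra.
rewrite /exp_integral PE ?QE ?(ltW xy)//.
have -> : P y - P x = (Q y - P x) + th y by rewrite /th; ring.
have -> : Q y - Q x = (Q y - P x) + th x by rewrite /th; ring.
by rewrite (expiD _ (th y)) (expiD _ (th x)) -mulrA E; ring.
Qed.

Lemma subordinate_itv (p : R -> M) (x x' : R) (i : J) (s : seq (J * R)) :
  subordinate U p x ((i, x') :: s) -> forall t, t \in `[x, x'] -> U i (p t).
Proof. by move=> [sub _] t tx; apply: sub; exists t. Qed.

Lemma subordinate_start (p : R -> M) (x x' : R) (i : J) (s : seq (J * R)) :
  x < x' -> subordinate U p x ((i, x') :: s) -> U i (p x).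
Proof. by move=> xx' /subordinate_itv; apply; rewrite in_itv/= lexx ltW. Qed.

Lemma path_last_ge (x : R) (s : seq R) : path <%R x s -> x <= last x s.
Proof.
elim: s x => //= y s IH x /andP[xy /IH]; exact/le_trans/ltW.
Qed.

(** Both partitions are traversed at the same time. Up to the smaller one of
    the two first cut points, z, each of them has a single label, and
    [gauge_transformation] moves g_ij from x to z. The interval that goes beyond z is split there by
    [transport_split]. Then (B1) absorbs the transition functions at z, and
    the induction applies to the remaining interval, where one of the lists,
    or both, has become shorter. *)
Lemma transport_relabel (a b : R) (p : R -> M) (i j : J) (x x1 y1 : R)
    (s s' : seq (J * R)) :
  flat_path a b p -> a <= x ->
  path <%R x (x1 :: map snd s) -> path <%R x (y1 :: map snd s') ->
  last x1 (map snd s) = b -> last y1 (map snd s') = b ->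
  subordinate U p x ((i, x1) :: s) -> subordinate U p x ((j, y1) :: s') ->
  transport B p x i x1 s *
    bg B (last i (map fst s)) (last j (map fst s')) (p b) =
  bg B i j (p x) * transport B p x j y1 s'.
Proof.
move=> fp.
have [m] := ubnP (size s + size s').
elim: m => // m IH in i j x x1 y1 s s' *.
move=> /[!ltnS] sm ax /= /andP[xx1 sx] /andP[xy1 sy] lx ly subx suby.
have Ux := subordinate_itv subx; have Uy := subordinate_itv suby.
have x1b : x1 <= b by rewrite -lx; exact: path_last_ge.
have y1b : y1 <= b by rewrite -ly; exact: path_last_ge.
have B1 k l q t : U k (p t) -> U l (p t) -> U q (p t) ->
    bg B k l (p t) * bg B l q (p t) = bg B k q (p t).
  by move=> *; apply: bundle_B1.
have [xy|yx|E] := ltgtP x1 y1.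
- case: s => [|[k x2] s] /= in sm sx lx subx *.
    by move: xy; rewrite lx ltNge y1b.
  have /= [_ subx'] := subx; have /andP[x12 _] := sx.
  have suby' : subordinate U p x1 ((j, y1) :: s').
    split; last exact: suby.2.
    move=> _ [t /= tx <-]; apply: Uy.
    by move: tx; rewrite !in_itv/= => /andP[? ?]; lra.
  have Uix1 : U i (p x1) by apply: Ux; rewrite in_itv/= lexx ltW.
  have Ukx1 : U k (p x1) := subordinate_start x12 subx'.
  have Ujx1 : U j (p x1) := subordinate_start xy suby'.
  rewrite (transport_split s' fp ax xx1 xy y1b Uy) [RHS]mulrA.
  rewrite -(gauge_transformation fp ax xx1 x1b); last first.
    move=> t txx; split; first exact: Ux.
    by apply: Uy; move: txx; rewrite !in_itv/= => /andP[? ?]; lra.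
  rewrite -!mulrA; congr (_ * _).
  rewrite (IH k j x1 x2 y1 s s')//=.
  + by rewrite mulrA B1.
  + lra.
  + by rewrite xy.
- case: s' => [|[l y2] s'] /= in sm sy ly suby *.
    by move: yx; rewrite ly ltNge x1b.
  have /= [_ suby'] := suby; have /andP[y12 _] := sy.
  have subx' : subordinate U p y1 ((i, x1) :: s).
    split; last exact: subx.2.
    move=> _ [t /= tx <-]; apply: Ux.
    by move: tx; rewrite !in_itv/= => /andP[? ?]; lra.
  have Ujy1 : U j (p y1) by apply: Uy; rewrite in_itv/= lexx ltW.
  have Uly1 : U l (p y1) := subordinate_start y12 suby'.
  have Uiy1 : U i (p y1) := subordinate_start yx subx'.
  rewrite (transport_split s fp ax xy1 yx x1b Ux) [RHS]mulrA.
  rewrite -(gauge_transformation fp ax xy1 y1b); last first.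
    move=> t txx; split; last exact: Uy.
    by apply: Ux; move: txx; rewrite !in_itv/= => /andP[? ?]; lra.
  rewrite -!mulrA; congr (_ * _).
  rewrite (IH i l y1 x1 y2 s s')//=.
  + by rewrite mulrA B1.
  + by move: sm; rewrite addnS.
  + lra.
  + by rewrite yx.
- subst y1.
  have Uix1 : U i (p x1) by apply: Ux; rewrite in_itv/= lexx ltW.
  have Ujx1 : U j (p x1) by apply: Uy; rewrite in_itv/= lexx ltW.
  case: s => [|[k x2] s] /= in sm sx lx subx *;
    case: s' => [|[l y2] s'] /= in sm sy ly suby *.
  + rewrite !mulr1 -lx.
    apply: (gauge_transformation fp ax xx1 x1b) => t tx.
    by split; [exact: Ux|exact: Uy].
  + by move: sy => /andP[y12 /path_last_ge]; rewrite ly -lx leNgt y12.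
  + by move: sx => /andP[x12 /path_last_ge]; rewrite lx -ly leNgt x12.
  + have /= [_ subx'] := subx; have /= [_ suby'] := suby.
    have /andP[x12 _] := sx; have /andP[y12 _] := sy.
    have Ukx1 : U k (p x1) := subordinate_start x12 subx'.
    have Ulx1 : U l (p x1) := subordinate_start y12 suby'.
    rewrite [RHS]mulrA -(gauge_transformation fp ax xx1 x1b); last first.
      by move=> t tx; split; [exact: Ux|exact: Uy].
    rewrite -!mulrA; congr (_ * _).
    rewrite (IH k l x1 x2 y2 s s')//=.
    * by rewrite !mulrA !B1.
    * by move: sm; rewrite addnS addSn => /ltnW.
    * lra.
Qed.

End Transport.

(** * Orientation-preserving diffeomorphisms of segments *)

Section Diffeo.
Context (R : realType) (a b a' b' : R) (f g : R -> R).
Hypothesis ab : a < b.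
Hypothesis ab' : a' < b'.
Hypothesis fP : forall t, t \in `[a, b] -> f t \in `[a', b'].
Hypothesis gP : forall t, t \in `[a', b'] -> g t \in `[a, b].
Hypothesis gK : forall t, t \in `[a', b'] -> f (g t) = t.
Hypothesis sf : smooth_on `[a, b]%classic f.
Hypothesis df : forall t, t \in `]a, b[ -> 0 < 'D_1 f t.

Lemma diffeo_derivable t : t \in `]a, b[ -> derivable f t 1.
Proof.
move=> tab; have [] // := @smooth_on_interior _ _ _ _ f t 1 sf _.
by apply: filterS (near_in_itvoo tab) => s; exact: subset_itv_oo_cc.
Qed.

(** The derivative is positive in the interior only; continuity carries strict
    monotonicity to the ends. *)
Lemma diffeo_lt : {in `[a, b] &, {homo f : x y / x < y}}.
Proof.
apply: gtr0_derive1_lt_cc; first exact: diffeo_derivable.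
  by move=> t tab; rewrite derive1E df.
exact: smooth_on_continuous.
Qed.

Lemma diffeo_inv_lt : {in `[a', b'] &, {homo g : x y / x < y}}.
Proof.
move=> x y xab yab xy; rewrite ltNge; apply/negP.
rewrite le_eqVlt => /orP[/eqP E|yx].
  by move: xy; rewrite -(gK xab) -(gK yab) E ltxx.
by have := diffeo_lt (gP yab) (gP xab) yx; rewrite !gK// ltNge (ltW xy).
Qed.

Lemma diffeo_segment x y t : x \in `[a', b'] -> y \in `[a', b'] ->
  t \in `[g x, g y] -> t \in `[a, b] /\ f t \in `[x, y].
Proof.
move=> xin yin; rewrite [_ \in `[g x, g y]]in_itv/= => /andP[xt ty].
have := gP xin; have := gP yin; rewrite !in_itv/= => /andP[_ yb] /andP[ax _].
have tab : t \in `[a, b] by rewrite in_itv/= (le_trans ax xt) (le_trans ty yb).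
have fle u v : u \in `[a, b] -> v \in `[a, b] -> u <= v -> f u <= f v.
  move=> uab vab; rewrite le_eqVlt => /orP[/eqP ->//|uv].
  by apply/ltW/diffeo_lt.
split; first by rewrite (le_trans ax xt) (le_trans ty yb).
by rewrite -{1}(gK xin) -{1}(gK yin) !fle// gP.
Qed.

(** The point g a' lies in [a, b]; if it were larger than a, then f a would be
    smaller than f (g a') = a'. *)
Lemma diffeo_inv_left : g a' = a.
Proof.
have a'in : a' \in `[a', b'] by rewrite in_itv/= lexx ltW.
have ain : a \in `[a, b] by rewrite in_itv/= lexx ltW.
have := gP a'in; rewrite in_itv/= => /andP[].
rewrite le_eqVlt => /orP[/eqP ->//|ag _].
have := diffeo_lt ain (gP a'in) ag; rewrite gK// => fa.
by have := fP ain; rewrite in_itv/= leNgt fa.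
Qed.

Lemma diffeo_inv_right : g b' = b.
Proof.
have b'in : b' \in `[a', b'] by rewrite in_itv/= lexx ltW.
have bin : b \in `[a, b] by rewrite in_itv/= lexx ltW.
have := gP b'in; rewrite in_itv/= => /andP[_].
rewrite le_eqVlt => /orP[/eqP ->//|gb].
have := diffeo_lt (gP b'in) bin gb; rewrite gK// => fb.
by have := fP bin; rewrite in_itv/= andbC leNgt fb.
Qed.

End Diffeo.

(** * Change of path *)

Section Reparametrisation.
Context (R : realType) (n : nat) (M : smoothManifold R n).
Context (J : Type) (U : J -> set M) (B : bundle_with_connection U).
Hypothesis oU : forall i, open (U i).

Lemma eq_pullback (p q : R -> M) (V : set M) (A : one_form V) (t : R) :
  (\forall s \near t, q s = p s) -> pullback A q t = pullback A p t.
Proof.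
move=> qp; rewrite /pullback (nbhs_singleton qp); congr form_at.
by apply: near_eq_derive; apply: filterS qp => s /= ->.
Qed.

(** The chart chosen at p t and at p' (f t) is the same one, so only the
    velocity changes, by the factor f' t. *)
Lemma pullback_reparam (a b a' b' : R) (p p' : R -> M) (f : R -> R)
    (V : set M) (A : one_form V) (t : R) :
  smooth_path a' b' p' -> t \in `]a, b[ -> f t \in `]a', b'[ ->
  derivable f t 1 -> (forall s, s \in `]a, b[ -> p s = p' (f s)) ->
  V (p t) ->
  pullback A p t = 'D_1 f t * pullback A p' (f t).
Proof.
move=> sp' tab fab dft pf; rewrite /pullback (pf t tab).
set c := chart_at _ => Vt.
have ct : chart_dom c (p' (f t)) := chart_at_dom _.
have [dp' _] := path_velocity sp' fab ct.
have -> : 'D_1 (chart_map c \o p) t =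
          'D_1 f t *: ('D_1 (chart_map c \o p') (f t) : 'rV[R]_n).
  transitivity ('D_1 ((chart_map c \o p') \o f) t : 'rV[R]_n).
    apply: near_eq_derive; apply: filterS (near_in_itvoo tab) => s sab /=.
    by rewrite pf.
  exact: derive_reparam.
have := form_linear A (conj Vt ct) ('D_1 f t) ('D_1 (chart_map c \o p') (f t)) 0.
by rewrite addr0 => ->; rewrite form_at0// addr0.
Qed.

Section TwoPaths.
Context (a b a' b' : R) (p p' : R -> M) (f g : R -> R).
Hypothesis gP : forall t, t \in `[a', b'] -> g t \in `[a, b].
Hypothesis gK : forall t, t \in `[a', b'] -> f (g t) = t.
Hypothesis sf : smooth_on `[a, b]%classic f.
Hypothesis df : forall t, t \in `]a, b[ -> 0 < 'D_1 f t.
Hypothesis fp : flat_path a b p.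
Hypothesis fp' : flat_path a' b' p'.
Hypothesis pf : forall t, t \in `[a, b] -> p t = p' (f t).

Let flt := diffeo_lt sf df.
Let glt := diffeo_inv_lt gP gK sf df.

(** Change of variables: if P and Q are primitives along p and p', then P and
    Q o f have the same derivative by [pullback_reparam]. *)
Lemma exp_integral_reparam (i : J) (x y : R) :
  a' <= x -> x < y -> y <= b' -> (forall t, t \in `[x, y] -> U i (p' t)) ->
  exp_integral B p' x i y = exp_integral B p (g x) i (g y).
Proof.
move=> ax xy yb Up'.
have xin : x \in `[a', b'] by rewrite in_itv/= ax (le_trans (ltW xy)).
have yin : y \in `[a', b'] by rewrite in_itv/= yb (le_trans ax (ltW xy)).
have gxy := glt xin yin xy.
have := gP xin; rewrite in_itv/= => /andP[agx _].
have := gP yin; rewrite in_itv/= => /andP[_ gyb].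
have sub t : t \in `[g x, g y] -> t \in `[a, b].
  by move=> /(diffeo_segment gP gK sf df xin yin)[].
have fin t : t \in `[g x, g y] -> f t \in `[x, y].
  by move=> /(diffeo_segment gP gK sf df xin yin)[].
have Up t : t \in `[g x, g y] -> U i (p t).
  by move=> txy; rewrite pf ?sub//; exact/Up'/fin.
have [P [cP dP PE]] := pullback_primitive (bA B i) fp (oU i) agx gxy gyb Up.
have [Q [cQ dQ QE]] := pullback_primitive (bA B i) fp' (oU i) ax xy yb Up'.
rewrite /exp_integral PE ?QE ?(ltW xy) ?(ltW gxy)//; congr expi.
have cf : {within `[g x, g y], continuous f}.
  by apply: continuous_subspaceW (smooth_on_continuous sf) => t; exact: sub.
have cQf := within_continuous_comp cf cQ fin.
pose F (t : R) : R := P t - Q (f t).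
have cF : {within `[g x, g y], continuous F}.
  by move=> t; apply: cvgB; [exact: cP|exact: cQf].
have dF t : t \in `]g x, g y[ -> is_derive t 1 F 0.
  move=> txy; have tab : t \in `]a, b[.
    by move: txy; rewrite !in_itv/= => /andP[? ?]; lra.
  have ftxy : f t \in `]x, y[.
    move: (txy); rewrite !in_itv/= => /andP[xt ty].
    by rewrite -{1}(gK xin) -{1}(gK yin) !flt ?gP//; exact: subset_itv_oo_cc.
  have dft := diffeo_derivable sf tab.
  have dPt := dP t txy; have dQt := dQ (f t) ftxy.
  have dQf : is_derive t 1 (Q \o f) ('D_1 f t * pullback (bA B i) p' (f t)).
    have [dq Eq] := dQt; apply: DeriveDef.
      by apply/derivable1_diffP/differentiable_comp; exact/derivable1_diffP.
    by rewrite -derive1E derive1_comp// !derive1E Eq mulrC.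
  apply: is_derive_eq (is_deriveB dPt dQf) _.
  rewrite (@pullback_reparam a b a' b' p p' f _ (bA B i) t fp'.1)//.
  - by rewrite subrr.
  - by move: ftxy; rewrite !in_itv/= => /andP[? ?]; lra.
  - by move=> s sab; apply: pf; exact: subset_itv_oo_cc.
  - by apply: Up; exact: subset_itv_oo_cc.
have E := derive0_eq_ends gxy cF dF.
by move: E; rewrite /F !gK// => E; lra.
Qed.

Let gmap (s : seq (J * R)) := [seq (u.1, g u.2) | u <- s].

(** The partition of the path p' is transported to p by the inverse
    diffeomorphism g; the labels, and by [exp_integral_reparam] all factors,
    are unchanged. The comparison of p with p' is thereby reduced to two
    partitions of p. *)
Lemma transport_reparam (i : J) (x x1 : R) (s : seq (J * R)) :
  a' <= x -> path <%R x (x1 :: map snd s) -> last x1 (map snd s) <= b' ->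
  subordinate U p' x ((i, x1) :: s) ->
  [/\ transport B p' x i x1 s = transport B p (g x) i (g x1) (gmap s),
      path <%R (g x) (g x1 :: map snd (gmap s)) &
      subordinate U p (g x) ((i, g x1) :: gmap s)].
Proof.
(* What one interval of the partition of p' becomes under g. *)
have step k y z : a' <= y -> y < z -> z <= b' ->
    p' @` `[y, z] `<=` U k ->
    [/\ exp_integral B p' y k z = exp_integral B p (g y) k (g z),
        g y < g z, p (g z) = p' z & p @` `[g y, g z] `<=` U k].
  move=> ay yz zb sub.
  have yin : y \in `[a', b'] by rewrite in_itv/= ay (le_trans (ltW yz)).
  have zin : z \in `[a', b'] by rewrite in_itv/= zb (le_trans ay (ltW yz)).
  have sub' t : t \in `[y, z] -> U k (p' t) by move=> tyz; apply: sub; exists t.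
  split; [exact: exp_integral_reparam|exact: glt|by rewrite pf ?gK ?gP//|].
  move=> _ [t tyz <-].
  have [tab ftyz] := diffeo_segment gP gK sf df yin zin tyz.
  by rewrite (pf tab); exact: sub'.
elim: s => [|[j x2] s IH] /= in i x x1 *.
  rewrite !andbT => ax xx1 x1b [Ux _].
  by have [-> ? _ ?] := step i x x1 ax xx1 x1b Ux; split.
move=> ax /andP[xx1 /andP[x12 sx]] lx [Ux subx].
have x1b : x1 <= b'.
  by apply: le_trans lx; apply: le_trans (ltW x12) (path_last_ge sx).
have [-> g1 pE sub1] := step i x x1 ax xx1 x1b Ux.
have x12s : (x1 < x2) && path <%R x2 (map snd s) by rewrite x12.
have [-> g2 sub2] := IH j x1 x2 (le_trans ax (ltW xx1)) x12s lx subx.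
by split; rewrite ?pE// g1.
Qed.

End TwoPaths.

Lemma transport_cat (q : R -> M) (i j : J) (x x1 y1 : R)
    (s s' : seq (J * R)) :
  transport B q x i x1 (s ++ (j, y1) :: s') =
  transport B q x i x1 s *
  bg B (last i (map fst s)) j (q (last x1 (map snd s))) *
  transport B q (last x1 (map snd s)) j y1 s'.
Proof.
elim: s => [|[k x2] s IH] /= in i x x1 *; first by rewrite mulr1 mulrA.
by rewrite IH !mulrA.
Qed.

(** The transition functions are evaluated at interior cut points and the ends
    have measure zero, so that the open interval ]a, b[ suffices. For the
    concatenation of two paths this avoids any discussion of its behaviour at
    the junction. *)
Lemma eq_transport (a b : R) (p q : R -> M) (i : J) (x x1 : R)
    (s : seq (J * R)) :
  flat_path a b p -> (forall t, t \in `]a, b[ -> q t = p t) ->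
  a <= x -> path <%R x (x1 :: map snd s) -> last x1 (map snd s) <= b ->
  subordinate U p x ((i, x1) :: s) ->
  transport B q x i x1 s = transport B p x i x1 s.
Proof.
move=> fp qp.
have step k y z : a <= y -> y < z -> z <= b -> p @` `[y, z] `<=` U k ->
    exp_integral B q y k z = exp_integral B p y k z.
  move=> ay yz zb sub; apply: (congr1 (@expi R)).
  have sub' t : t \in `[y, z] -> U k (p t) by move=> tyz; apply: sub; exists t.
  have [F [cF pF]] := pullback_extension (bA B k) fp (oU k) ay zb sub'.
  have cF' t : t \in `]y, z[ -> {for t, continuous F}.
    by move=> tyz; apply: cF; exact: subset_itv_oo_cc.
  have qF t : t \in `]y, z[ -> pullback (bA B k) q t = F t; last first.
    have Eq := eq_Rintegral_oo cF' qF.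
    have Ep := eq_Rintegral_oo cF' pF.
    exact: etrans Eq (esym Ep).
  move=> tyz; rewrite -pF//; apply: eq_pullback.
  have : t \in `]a, b[ by move: tyz; rewrite !in_itv/= => /andP[? ?]; lra.
  by move/near_in_itvoo; apply: filterS => u; exact: qp.
elim: s => [|[j x2] s IH] /= in i x x1 *.
  by rewrite !andbT => ax xx1 x1b [Ux _]; rewrite step.
move=> ax /andP[xx1 /andP[x12 sx]] lx [Ux subx].
have x1b : x1 < b.
  by apply: lt_le_trans lx; apply: lt_le_trans x12 (path_last_ge sx).
have ax1 : a < x1 by exact: le_lt_trans xx1.
rewrite step ?(ltW x1b)// qp ?in_itv/= ?ax1//; congr (_ * (_ * _)).
by apply: IH => //; [exact: ltW|rewrite /= x12].
Qed.

Lemma norm_transport (p : R -> M) (i : J) (x x1 : R) (s : seq (J * R)) :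
  path <%R x (x1 :: map snd s) -> subordinate U p x ((i, x1) :: s) ->
  `|transport B p x i x1 s| = 1.
Proof.
elim: s => [|[j x2] s IH] /= in i x x1 *.
  by rewrite mulr1 norm_expi.
move=> /andP[xx1 sx] [Ux subx]; rewrite !normrM norm_expi mul1r.
rewrite (IH j x1 x2)// mulr1; apply: (bg_U1 B); split.
  by apply: Ux; exists x1 => //=; rewrite in_itv/= lexx ltW.
by case/andP: sx => x12 _; exact: subordinate_start x12 subx.
Qed.

End Reparametrisation.

(** * The field theory of a bundle with connection *)

Section Objects.
Context (R : realType) (n : nat) (M : smoothManifold R n).
Context (J : Type) (U : J -> set M).

Lemma is_object_flat (p : R -> M) (T : lpartition R J) :
  is_object U p T -> flat_path (lp_start T) (lp_end T) p.
Proof. by case. Qed.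

Lemma is_object_path (p : R -> M) (T : lpartition R J) : is_object U p T ->
  path <%R (lp_start T) (lp_cut T :: [seq u.2 | u <- lp_tail T]).
Proof. by case. Qed.

Lemma is_object_lt (p : R -> M) (T : lpartition R J) :
  is_object U p T -> lp_start T < lp_end T.
Proof.
move=> /is_object_path /= /andP[lt1 /path_last_ge]; exact: lt_le_trans.
Qed.

End Objects.

Theorem theorem3p4 (R : realType) (n : nat) (M : smoothManifold R n)
    (J : Type) (U : J -> set M) (hU : good_cover R U)
    (B : bundle_with_connection U) :
  is_TQFT U (bundle_Z' B) (bundle_Z B).
Proof.
have [oU _ _] := hU.
split.
- by case=> y i j Uij; rewrite /U1/= ?norm_conjC; exact: (bg_U1 B).
- move=> p T objT; apply: norm_transport; last by case: objT.
  exact: is_object_path objT.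
- case=> y i j k Uijk /=; first exact: bundle_B1.
  by rewrite -rmorphM; congr (_^*); exact: bundle_B1.
- move=> p T p' T' f objT objT' [g [[fP gP fK gK] sf _ df]] pf.
  have ab := is_object_lt objT; have ab' := is_object_lt objT'.
  have ga : g (lp_start T') = lp_start T.
    exact: diffeo_inv_left ab ab' fP gP gK sf df.
  have gb : g (lp_end T') = lp_end T.
    exact: diffeo_inv_right ab ab' fP gP gK sf df.
  have [_ _ _ sub] := objT; have [_ _ _ sub'] := objT'.
  have fl := is_object_flat objT; have fl' := is_object_flat objT'.
  have pa := is_object_path objT; have pa' := is_object_path objT'.
  have [E pg subg] := transport_reparam B oU gP gK sf df fl fl' pf
    (lexx _) pa' (lexx _) sub'.
  rewrite ga in E pg subg.
  set gT' := [seq (u.1, g u.2) | u <- lp_tail T'] in E pg subg.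
  have lastg : last (g (lp_cut T')) [seq u.2 | u <- gT'] = lp_end T.
    by rewrite -gb /lp_end /= -(last_map g) -!map_comp.
  have lab : last (lp_head T') [seq u.1 | u <- gT'] = lp_last T'.
    by rewrite -map_comp.
  have := transport_relabel B oU fl (lexx _) pa pg erefl lastg sub subg.
  rewrite lab -mulrA /bundle_Z => -> /=; rewrite E mulrA.
  have /andP[lt1 _] := pa; have /andP[lt2 _] := pg.
  have Ui := subordinate_start lt1 sub; have Uj := subordinate_start lt2 subg.
  by rewrite [_^* * _]mulrC -normCK (bg_U1 B (conj Ui Uj)) expr1n mul1r.
- move=> p T p' T' objT objT' eT ep /=.
  have fl := is_object_flat objT; have fl' := is_object_flat objT'.
  have pa := is_object_path objT; have pa' := is_object_path objT'.
  have [_ _ _ sub] := objT; have [_ _ _ sub'] := objT'.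
  have lE : last (lp_cut T) [seq u.2 | u <- lp_tail T] = lp_end T by [].
  have qE : path_concat p p' (lp_end T) (lp_end T) = p (lp_end T).
    by rewrite /path_concat lexx.
  rewrite /bundle_Z /lp_concat/= transport_cat lE qE; congr (_ * _ * _).
    apply: (eq_transport B oU fl _ (lexx _) pa (lexx _) sub).
    by move=> t; rewrite in_itv/= /path_concat => /andP[_ /ltW ->].
  rewrite eT; apply: (eq_transport B oU fl' _ (lexx _) pa' (lexx _) sub').
  by move=> t; rewrite in_itv/= /path_concat -eT leNgt => /andP[-> _].
Qed.
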